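(* Let $K_A,K_B$ be state spaces. There is a constant $c(A,B)$, depending only on $K_A$ and $K_B$, such that the following two statements hold with this same constant. (i) (de Finetti bound) For every $n\ge1$ and every $x_{AB}\in\operatorname{Ext}_n(K_A,K_B)$ there is $\tilde x_{AB}\in K_A\dot\otimes K_B$ with $\|\tilde x_{AB}-x_{AB}\|_{\star,1_{K_A\hat\otimes K_B}}\le 2c(A,B)/\sqrt n$. (ii) For every linear functional $P$ on $A(K_A)^\star\otimes A(K_B)^\star$, all linear constraint maps $F_A,F_B,G_A,G_B$ as in the context, and every $n\in\mathbb N$, the optimal values $$p^*=\min\{P(x_A\otimes x_B): x_A\in K_A,\ x_B\in K_B,\ F_A(x_A)=0,\ F_B(x_B)=0,\ G_A(x_A)\ge0,\ G_B(x_B)\ge0\}$$ and $$p^{(n)}=\inf\{P(x_{AB}):x_{AB}\in\Sigma^n(A:B)\}$$ satisfy $$0\le p^*-p^{(n)}\le\frac{2\,\|P\|_{1_{K_A\hat\otimes K_B}}\,c(A,B)}{\sqrt n}.$$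
   Context: A state space is a nonempty compact convex subset $K$ of a finite-dimensional real vector space. $A(K)$ is the space of affine functions $K\to\mathbb R$, $A(K)^+$ the cone of nonnegative ones, $1_K$ the constant function $1$. $A(K)^\star$ is the dual space with dual cone $A(K)^{\star+}$; $K$ is identified with $\{\phi\in A(K)^{\star+}:\langle\phi,1_K\rangle=1\}$. For cones $C_i\subseteq V_i$, $C_1\hat\otimes C_2=\{z\in V_1\otimes V_2:(f_1\otimes f_2)(z)\ge0\ \forall f_i\in C_i^\star\}$ (iterated associatively). $K_A\hat\otimes K_B$ (and likewise $K_A\hat\otimes K_B^{\hat\otimes n}$) is the set of elements of $A(K_A)^{\star+}\hat\otimes A(K_B)^{\star+}$ on which $1_{K_A}\otimes1_{K_B}$ equals $1$. $K_A\dot\otimes K_B=\operatorname{conv}\{x_A\otimes x_B:x_A\in K_A,x_B\in K_B\}$. $\operatorname{Ext}_n(K_A,K_B)$ is the set of $x_{AB}\in K_A\hat\otimes K_B$ possessing an $n$-extension, i.e. some $y_{AB^n}\in K_A\hat\otimes K_B^{\hat\otimes n}$ invariant under all permutations of the $n$ $B$-factors with $x_{AB}=(\mathrm{id}_A\otimes\mathrm{id}_B\otimes1_{K_B}^{\otimes(n-1)})(y_{AB^n})$. Constraints: $F_A:A(K_A)^\star\to U_A$, $F_B:A(K_B)^\star\to U_B$ are linear maps into finite-dimensional real vector spaces; $G_A:A(K_A)^\star\to W_A$, $G_B:A(K_B)^\star\to W_B$ are linear maps into finite-dimensional ordered real vector spaces (ordered by proper cones, i.e. closed, convex, generating, pointed).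 Inequalities for elements of a tensor product such as $W_A\otimes (A(K_B)^\star)^{\otimes n}$ refer to the maximal tensor product of the positive cones of the factors. $\Sigma^n(A:B)$ is the set of $x_{AB}\in\operatorname{Ext}_n(K_A,K_B)$ having an $n$-extension $y_{AB^n}$ (i.e. some $y_{AB^n}\in K_A\hat\otimes K_B^{\hat\otimes n}$ invariant under all permutations of the $n$ $B$-factors with $x_{AB}=(\mathrm{id}_A\otimes\mathrm{id}_B\otimes1_{K_B}^{\otimes(n-1)})(y_{AB^n})$) which in addition satisfies (a) $(F_A\otimes\mathrm{id}_{B^n})(y_{AB^n})=0$; (b) $(\mathrm{id}_A\otimes F_B\otimes\mathrm{id}_{B^{n-1}})(y_{AB^n})=0$; (c) $(G_A\otimes\mathrm{id}_{B^n})(y_{AB^n})\ge0$; (d) $(\mathrm{id}_A\otimes G_B\otimes\mathrm{id}_{B^{n-1}})(y_{AB^n})\ge0$. The problem defining $p^*$ is assumed feasible, so that $p^*$ is a well-defined real number. Norms: for $f\in A(K)$, $\|f\|_{1_K}=\inf\{t\ge0:-t1_K\le f\le t1_K\}$; for $\phi\in A(K)^\star$, $\|\phi\|_{\star,1_K}=\sup\{|\langle\phi,g\rangle|:\|g\|_{1_K}\le1\}$. $P$ is regarded as an element of $A(K_A\hat\otimes K_B)\cong A(K_A)\otimes A(K_B)$, with $1_{K_A\hat\otimes K_B}=1_{K_A}\otimes1_{K_B}$. *)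

(* Defs.v *)
From HB Require Import structures.
From mathcomp Require Import all_boot all_order all_algebra perm.
From mathcomp Require Import all_classical all_reals all_analysis.

Set Implicit Arguments.
Unset Strict Implicit.
Unset Printing Implicit Defensive.

Import Order.TTheory GRing.Theory Num.Theory.
Import numFieldNormedType.Exports.

Local Open Scope classical_set_scope.
Local Open Scope ring_scope.

Section FiniteDim.
Context {R : realType} {V : vectType R}.

(* A vectType carries no topology. All linear coordinate systems induce the
   same one, so topological notions are read in the basis [vbasis fullv]. *)
Definition coords (v : V) : 'rV[R]_(\dim {:V}) :=
  \row_i coord (vbasis {:V}) i v.

Definition state_space (K : set V) : Prop :=
  [/\ K !=set0, compact (coords @` K) & convex_set K].

Definition proper_cone (C : set V) : Prop :=
  [/\ C 0 /\ (forall (a : R) w, 0 <= a -> C w -> C (a *: w)),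
      convex_set C,
      closed (coords @` C),
      forall w, exists w1 w2, [/\ C w1, C w2 & w = w1 - w2]
    & forall w, C w -> C (- w) -> w = 0].

End FiniteDim.

Section AffineFunctions.
Context {R : realType} {V : lmodType R}.

Definition affine (K : set V) : {pred (K -> R^o)} := fun f =>
  `[< forall (x y z : K) (t : R), 0 <= t <= 1 ->
        val z = t *: val x + (1 - t) *: val y ->
        f z = t * f x + (1 - t) * f y >].

Fact affine_submod_closed K : submod_closed (@affine K).
Proof.
split.
  by apply/asboolP => x y z t _ _; rewrite !mulr0 addr0.
move=> a f g /asboolP fA /asboolP gA; apply/asboolP => x y z t t01 E.
have sumE u : (a *: f + g) u = a * f u + g u by [].
rewrite !sumE (fA _ _ _ _ t01 E) (gA _ _ _ _ t01 E) !mulrDr.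
by rewrite !(mulrCA a) addrACA.
Qed.

HB.instance Definition _ (K : set V) := GRing.isSubmodClosed.Build R (K -> R^o)
  (@affine K) (affine_submod_closed K).

Record A (K : set V) := AffineFun {
  affine_fun :> K -> R^o;
  _ : affine_fun \in @affine K }.

HB.instance Definition _ (K : set V) := [isSub for @affine_fun K].
HB.instance Definition _ (K : set V) := [Choice of A K by <:].
HB.instance Definition _ (K : set V) := [SubChoice_isSubLmodule of A K by <:].

Fact affine_one K : (fun=> 1) \in @affine K.
Proof. by apply/asboolP => x y z t _ _; rewrite !mulr1 addrC subrK. Qed.

Definition unit_fun (K : set V) : A K := AffineFun (affine_one K).

Definition A_pos (K : set V) : set (A K) := [set f | forall x, 0 <= f x].

End AffineFunctions.

Section Dual.
Context {R : realType}.

Definition linear_form (U : lmodType R) : {pred (U -> R^o)} :=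
  fun f => `[< scalar f >].

Fact linear_form_submod_closed U : submod_closed (@linear_form U).
Proof.
split.
  by apply/asboolP => a u v; rewrite mulr0 addr0.
move=> a f g /asboolP fL /asboolP gL; apply/asboolP => b u v.
have sumE w : (a *: f + g) w = a * f w + g w by [].
by rewrite !sumE fL gL !mulrDr !(mulrCA a) addrACA.
Qed.

HB.instance Definition _ (U : lmodType R) := GRing.isSubmodClosed.Build R (U -> R^o)
  (@linear_form U) (linear_form_submod_closed U).

Record dual (U : lmodType R) := Dual {
  dual_fun :> U -> R^o;
  _ : dual_fun \in @linear_form U }.

HB.instance Definition _ (U : lmodType R) := [isSub for @dual_fun U].
HB.instance Definition _ (U : lmodType R) := [Choice of dual U by <:].
HB.instance Definition _ (U : lmodType R) := [SubChoice_isSubLmodule of dual U by <:].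

Fact dual_fun_scalar U (phi : dual U) : scalar phi.
Proof. by case: phi => f fL; exact: asboolW fL. Qed.

HB.instance Definition _ (U : lmodType R) (phi : dual U) :=
  GRing.isLinear.Build R U R^o *%R (dual_fun phi) (dual_fun_scalar phi).

Definition dual_cone (U : lmodType R) (C : set U) : set (dual U) :=
  [set u | forall w, C w -> 0 <= u w].

(* the embedding of K in A(K)^* *)
Fact state_scalar (V : lmodType R) (K : set V) (x : K) :
  (fun f : A K => f x) \in @linear_form (A K).
Proof. by apply/asboolP. Qed.

Definition state (V : lmodType R) (K : set V) (x : K) : dual (A K) :=
  Dual (state_scalar x).

End Dual.

(* For finite-dimensional U, U1, ..., Un, the tensor product
   U^* (x) U1^* (x) ... (x) Un^* is the space of multilinear forms on
   U x U1 x ... x Un; an elementary tensor is a product of linear forms.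
   The factors are given through their preduals because A(K) is the
   (pre)dual of the space A(K)^* in which the states live. *)
Section Tensor.
Context {R : realType}.

Definition bilinear_form (U V : lmodType R) : {pred (U -> V -> R^o)} :=
  fun z => `[< (forall v, scalar (fun u => z u v)) /\
               (forall u, scalar (z u)) >].

Fact bilinear_form_submod_closed U V : submod_closed (@bilinear_form U V).
Proof.
split.
  by apply/asboolP; split=> w a u v; rewrite mulr0 addr0.
move=> a f g /asboolP[fl fr] /asboolP[gl gr].
have sumE u v : (a *: f + g) u v = a * f u v + g u v by [].
by apply/asboolP; split=> w b u v;
  rewrite !sumE ?fl ?fr ?gl ?gr !mulrDr !(mulrCA a) addrACA.
Qed.

HB.instance Definition _ (U V : lmodType R) := GRing.isSubmodClosed.Build R (U -> V -> R^o)
  (@bilinear_form U V) (bilinear_form_submod_closed U V).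

(* U^* (x) V^* *)
Record tensor (U V : lmodType R) := Tensor {
  tensor_fun :> U -> V -> R^o;
  _ : tensor_fun \in @bilinear_form U V }.

HB.instance Definition _ (U V : lmodType R) := [isSub for @tensor_fun U V].
HB.instance Definition _ (U V : lmodType R) := [Choice of tensor U V by <:].
HB.instance Definition _ (U V : lmodType R) := [SubChoice_isSubLmodule of tensor U V by <:].

Fact pure_bilinear (U V : lmodType R) (phi : dual U) (psi : dual V) :
  (fun u v => phi u * psi v) \in @bilinear_form U V.
Proof.
apply/asboolP; split=> [v a u u'|u a v v'].
  by rewrite linearP mulrDl mulrA.
by rewrite linearP mulrDr mulrCA.
Qed.

Definition pure (U V : lmodType R) (phi : dual U) (psi : dual V) :
  tensor U V := Tensor (pure_bilinear phi psi).

(* U^* (x) V^* (x) ... (x) V^* with n factors V^* *)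
Record ntensor (U V : lmodType R) (n : nat) := NTensor {
  ntensor_fun :> U -> ('I_n -> V) -> R^o;
  ntensor_scalarl : forall g, scalar (fun u => ntensor_fun u g);
  ntensor_scalarr : forall u g i,
    scalar (fun v => ntensor_fun u [eta g with i |-> v]) }.

Section Slices.
Context {U V : lmodType R} {n : nat} (y : ntensor U V n).

Fact slicel_scalar g : (fun u => y u g) \in @linear_form R U.
Proof. by apply/asboolP; exact: ntensor_scalarl. Qed.

Definition slicel g : dual U := Dual (slicel_scalar g).

Fact slicer_scalar u g i :
  (fun v => y u [eta g with i |-> v]) \in @linear_form R V.
Proof. by apply/asboolP; exact: ntensor_scalarr. Qed.

Definition slicer u g i : dual V := Dual (slicer_scalar u g i).

(* (F (x) id)(y) and (id (x) F (x) id)(y), the latter with F on the i-th copy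
   of V^*, as multilinear maps with values in the target W of F.  In the second
   one the i-th entry of the argument g is irrelevant. *)
Definition mapl (W : lmodType R) (F : {linear dual U -> W})
    (g : 'I_n -> V) : W := F (slicel g).

Definition mapr (W : lmodType R) (F : {linear dual V -> W}) (i : 'I_n)
    (u : U) (g : 'I_n -> V) : W := F (slicer u g i).

End Slices.

End Tensor.

Section StateSpaces.
Context {R : realType} {VA VB : lmodType R} (KA : set VA) (KB : set VB).

(* The cone A(K)^{*+} is the dual of A(K)^+, and its own dual cone is A(K)^+;
   hence the maximal tensor product consists of the forms that are nonnegative
   on nonnegative functions. *)
Definition max_tensor : set (tensor (A KA) (A KB)) :=
  [set z | (forall f g, A_pos f -> A_pos g -> 0 <= z f g) /\
           z (unit_fun KA) (unit_fun KB) = 1].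

Definition max_ntensor n : set (ntensor (A KA) (A KB) n) :=
  [set y | (forall f g, A_pos f -> (forall j, A_pos (g j)) -> 0 <= y f g) /\
           y (unit_fun KA) (fun=> unit_fun KB) = 1].

Definition min_tensor : set (tensor (A KA) (A KB)) :=
  smallest (@convex_set R (tensor (A KA) (A KB)))
    [set pure (state p.1) (state p.2) | p in [set: KA * KB]].

Definition extension n (x : tensor (A KA) (A KB))
    (y : ntensor (A KA) (A KB) n) : Prop :=
  [/\ max_ntensor y,
      forall (s : 'S_n) f g, y f (fun i => g (s i)) = y f g
    & forall f g,
        x f g = y f (fun i => if val i == 0%N then g else unit_fun KB)].

Definition Ext n : set (tensor (A KA) (A KB)) :=
  [set x | max_tensor x /\ exists y : ntensor (A KA) (A KB) n, extension x y].

Section Constraints.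
Context {UA UB WA WB : lmodType R}.
Context (FA : {linear dual (A KA) -> UA}) (FB : {linear dual (A KB) -> UB}).
Context (GA : {linear dual (A KA) -> WA}) (CA : set WA).
Context (GB : {linear dual (A KB) -> WB}) (CB : set WB).

Definition feasible (p : KA * KB) : Prop :=
  [/\ FA (state p.1) = 0, FB (state p.2) = 0,
      CA (GA (state p.1)) & CB (GB (state p.2))].

Definition Sigma n : set (tensor (A KA) (A KB)) :=
  [set x | Ext n x /\ exists y : ntensor (A KA) (A KB) n, extension x y /\
    [/\ forall g, mapl y FA g = 0,
        forall i : 'I_n, val i = 0%N -> forall f g, mapr y FB i f g = 0,
        forall w g, dual_cone CA w -> (forall j, A_pos (g j)) ->
          0 <= w (mapl y GA g)
      & forall i : 'I_n, val i = 0%N -> forall f w g,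
          A_pos f -> dual_cone CB w -> (forall j, A_pos (g j)) ->
          0 <= w (mapr y GB i f g)]].

End Constraints.

End StateSpaces.

Arguments max_tensor {R VA VB} KA KB _.
Arguments max_ntensor {R VA VB} KA KB n _.
Arguments min_tensor {R VA VB} KA KB _.
Arguments Ext {R VA VB} KA KB n _.

(* Norms for a compact convex S spanning E and contained in an affine hyperplane
   that misses 0, as max_tensor KA KB is.  Restriction to S then identifies the dual of E with A(S),
   and E with A(S)^*. *)
Section Norms.
Context {R : realType} {E : lmodType R} (S : set E).

Definition unit_norm (f : dual E) : R :=
  inf [set t : R | 0 <= t /\ forall x, S x -> - t <= f x <= t].

Definition base_norm (phi : E) : R :=
  sup [set `|g phi| | g in [set g : dual E | unit_norm g <= 1]].

End Norms.

Definition minimum {R : realType} (S : set R) (m : R) : Prop :=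
  S m /\ lbound S m.

(* Main.v *)
From HB Require Import structures.
Require Import Defs.
From mathcomp Require Import all_boot all_order all_algebra perm ring lra.
From mathcomp Require Import all_classical all_reals all_analysis.

Set Implicit Arguments.
Unset Strict Implicit.
Unset Printing Implicit Defensive.

Import Order.TTheory GRing.Theory Num.Theory.
Import numFieldNormedType.Exports.

Local Open Scope classical_set_scope.
Local Open Scope ring_scope.

(** The proof is a martingale argument.  Let [y] be a symmetric extension of [x] to
    [n] copies of B.  An informationally complete measurement on B
    ([measurement_exists]) is applied to the copies one after the other.  For a
    fixed affine function [f] on the state space of A with [|f| <= M], the
    posterior expectations of [f] given the outcomes form a martingale bounded by
    [M], so their second moments increase to at most [M ^+ 2].  Among the [n]
    steps there is therefore one, after [k] outcomes, whose increment is of order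
    [1 / n] ([posterior_stabilizes]).  This increment is the variance of the
    posterior expectation under one further measurement.  It measures in mean square
    how far A and the next copy of B are from being independent given the first [k]
    outcomes, and the mean deviation is of order [1 / sqrt n].

    Conditioned on [k] outcomes, A and the next copy of B are in states which are
    slices of [y].  The mixture of their products over all outcomes is separable
    and close to [x] on a frame of [A(K_A)] and on the measurement effects.  As
    these span and the corresponding dual families consist of multiples of states,
    closeness on finitely many pairs of functions gives closeness in base norm
    ([dual_tensor_le]).  This is [de_finetti].  Its constant is made of the sizes and
    bounds of the frame and the measurement, which depend on the two state spaces
    only.

    The conditional states inherit the constraints imposed on [y]
    ([conditional_feasible]).  Hence a linear functional [P] is at least its
    constrained minimum on each product of the mixture, and its value on [x] can be
    lower only by the approximation error.  Conversely a feasible product state has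
    its own symmetric powers as extensions ([product_Sigma]), so the relaxed value
    is at most the minimum.

    Convexity enters through the separation of points from closed convex sets. It
    identifies the normalized positive functionals on [A(K)] with the points of [K]
    ([positive_state]), and turns inequalities stated by duality into membership in
    the cones ([bipolar]). *)

(** * Separation in coordinate space *)

Lemma convex_setP (R : realType) (V : lmodType R) (C : set V) :
  convex_set C <-> forall x y (t : R), C x -> C y -> 0 <= t <= 1 ->
    C (t *: x + (1 - t) *: y).
Proof.
split=> [cC x y t Cx Cy /andP[t0 t1]|cC x y t /set_mem Cx /set_mem Cy].
  have ti : Itv.spec (Itv.num_sem (R:=R)) (Itv.Real `[0%Z, 1%Z]) t.
    by apply/and3P; split; rewrite /= ?num_real//= bnd_simp ?t0.
  have /set_mem := cC x y (Itv.mk ti) (mem_set Cx) (mem_set Cy).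
  by [].
by apply/mem_set/cC => //; rewrite ge0 le1.
Qed.

Section RowVectors.
Context {R : realType}.

Definition dot n (u v : 'rV[R]_n) : R := \sum_i u 0 i * v 0 i.

Lemma dotD n (u v w : 'rV[R]_n) : dot u (v + w) = dot u v + dot u w.
Proof. by rewrite /dot -big_split; apply: eq_bigr => i _; rewrite mxE mulrDr. Qed.

Lemma dotZ n a (u v : 'rV[R]_n) : dot u (a *: v) = a * dot u v.
Proof.
by rewrite /dot big_distrr; apply: eq_bigr => i _; rewrite mxE mulrCA.
Qed.

Lemma dotC n (u v : 'rV[R]_n) : dot u v = dot v u.
Proof. by apply: eq_bigr => i _; rewrite mulrC. Qed.

Lemma dotB n (u v w : 'rV[R]_n) : dot u (v - w) = dot u v - dot u w.
Proof. by rewrite -scaleN1r dotD dotZ mulN1r. Qed.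

Lemma dot_line n (u v : 'rV[R]_n) t :
  dot (u + t *: v) (u + t *: v) = dot u u + 2 * t * dot u v + t ^+ 2 * dot v v.
Proof.
rewrite dotD dotZ !(dotC (u + _)) !dotD !dotZ (dotC v u); ring.
Qed.

Lemma dot_ge0 n (u : 'rV[R]_n) : 0 <= dot u u.
Proof. by apply: sumr_ge0 => i _; rewrite -expr2 sqr_ge0. Qed.

Lemma dot_eq0 n (u : 'rV[R]_n) : dot u u = 0 -> u = 0.
Proof.
move=> /eqP; rewrite psumr_eq0 => [/allP u0|i _]; last first.
  by rewrite -expr2 sqr_ge0.
apply/rowP => i; rewrite mxE.
by have := u0 i (mem_index_enum i); rewrite -expr2 sqrf_eq0 => /eqP.
Qed.

(** The topology of row vectors comes from the maximum norm, whereas projections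
    need the Euclidean one; this crude comparison is enough for boundedness. *)
Lemma sqr_norm_le n (u : 'rV[R]_n) : `|u| <= 1 + dot u u.
Proof.
rewrite [leLHS]/Num.norm /= mx_normrE.
apply/bigmax_leP; split=> [|[i j] _ /=].
  by rewrite addr_ge0 ?dot_ge0.
rewrite ord1; have : u 0 j ^+ 2 <= dot u u.
  rewrite /dot (bigD1 j)//= -expr2 lerDl sumr_ge0// => k _.
  by rewrite -expr2 sqr_ge0.
move: (u 0 j) (dot u u) => a b; rewrite -real_normK ?num_real//.
by have := normr_ge0 a; move: `|a| => c; nra.
Qed.

Lemma continuous_sum (T : topologicalType) (I : Type) (r : seq I) (P : pred I)
    (f : I -> T -> R) :
  (forall i, continuous (f i)) -> continuous (fun x => \sum_(i <- r | P i) f i x).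
Proof.
move=> fc; apply: continuous_big => [|i _]; [exact: add_continuous|exact: fc].
Qed.

Lemma row_continuous (T : topologicalType) n (f : T -> 'rV[R]_n) :
  (forall i, continuous (fun x => f x 0 i)) -> continuous f.
Proof.
move=> fc x; apply/cvg_ballP => e e0.
have : \forall t \near x, forall i, ball (f x 0 i) e (f t 0 i).
  apply: filter_forall => i; have /cvg_ballP := fc i x; exact.
apply: filterS => t tb; split => // i j; rewrite ord1; exact: tb.
Qed.

Lemma dot_continuous n (u : 'rV[R]_n) : continuous (dot u).
Proof.
apply: continuous_sum => i x.
by apply: (@continuousM R _ (fun=> u 0 i)); [exact: cst_continuous|exact: (@coord_continuous R 1 n 0 i)].
Qed.

Lemma dist_continuous n (w : 'rV[R]_n) :
  continuous (fun x : 'rV[R]_n => dot (x - w) (x - w)).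
Proof.
have -> : (fun x : 'rV[R]_n => dot (x - w) (x - w)) =
    (fun x => \sum_i (x 0 i - w 0 i) * (x 0 i - w 0 i)).
  by apply/funext => x; apply: eq_bigr => i _; rewrite !mxE.
apply: continuous_sum => i x.
have c : {for x, continuous (fun x : 'rV[R]_n => x 0 i - w 0 i)}.
  apply: (@continuousB R _ _ (fun x : 'rV[R]_n => x 0 i) (fun=> w 0 i)).
    exact: (@coord_continuous R 1 n 0 i).
  exact: cst_continuous.
exact: (continuousM c c).
Qed.

(** Only the part of [C] that is no farther from [w] than a given point of [C]
    matters, and that part is compact. *)
Lemma nearest_point n (C : set 'rV[R]_n) (w : 'rV[R]_n) :
  C !=set0 -> closed C ->
  exists2 m, C m & forall x, C x -> dot (m - w) (m - w) <= dot (x - w) (x - w).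
Proof.
move=> [c Cc] clC.
pose q x := dot (x - w) (x - w).
pose D := C `&` [set x | q x <= q c].
have clD : closed D.
  apply: closedI => //.
  have /continuous_closedP qc := dist_continuous (w := w).
  exact: qc _ (@closed_le R (q c)).
have bD : bounded_set D.
  exists (`|w| + 1 + q c); split; first exact: num_real.
  move=> M hM x [_ /= qx].
  have -> : x = (x - w) + w by rewrite subrK.
  apply: le_trans (ler_normD _ _) _.
  have := sqr_norm_le (x - w); rewrite -/(q x) => h.
  lra.
have D0 : D !=set0 by exists c; split => //=.
have qc : {within D, continuous q}.
  by apply: continuous_subspaceT; exact: dist_continuous.
have [m /set_mem[Cm qm] mmin] :=
  EVT_min_rV D0 (bounded_closed_compact bD clD) qc.
exists m => // x Cx; have [qx|qx] := leP (q x) (q c).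
  by apply: mmin; apply/mem_set; split.
exact: le_trans qm (ltW qx).
Qed.

(** If [m] is the point of [C] nearest to [w], then [C] lies on the far side of
    the hyperplane through [m] orthogonal to [m - w]. *)
Lemma strict_separation n (C : set 'rV[R]_n) (w : 'rV[R]_n) :
  C !=set0 -> closed C -> convex_set C -> ~ C w ->
  exists u c, dot u w < c /\ forall x, C x -> c <= dot u x.
Proof.
move=> C0 clC /convex_setP cC nCw.
have [m Cm mmin] := nearest_point w C0 clC.
pose u := m - w; exists u, (dot u m); split.
  rewrite -subr_gt0 -dotB -/u lt_neqAle dot_ge0 andbT.
  apply/negP => /eqP/esym/dot_eq0/eqP; rewrite subr_eq0 => /eqP mw.
  by apply: nCw; rewrite -mw.
move=> x Cx; rewrite -subr_ge0 -dotB leNgt; apply/negP => s0.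
pose v := x - m; rewrite -/v in s0.
have v0 := dot_ge0 v.
(* moving from [m] towards [x] by [t] changes the squared distance to [w] by
   [t * (2 * dot u v + t * dot v v)], which is negative for the [t] below *)
pose t := - dot u v / (- dot u v + dot v v).
have d0 : 0 < - dot u v + dot v v by lra.
have t0 : 0 < t by rewrite divr_gt0//; lra.
have t1 : t <= 1 by rewrite ler_pdivrMr//; lra.
have tE : t * (- dot u v + dot v v) = - dot u v by rewrite divfK// gt_eqF.
have := mmin _ (cC x m t Cx Cm _); rewrite t1 ltW// => /(_ isT).
have -> : t *: x + (1 - t) *: m - w = u + t *: v.
  by rewrite /u /v scalerBr scalerBl scale1r addrCA addrAC !addrA addrAC.
rewrite -/u dot_line.
nra.
Qed.

End RowVectors.

(** * Affine functions and finite affine combinations *)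

(** Normalizing by the total weight avoids dividing by partial sums in the
    statement, and points of weight zero need not belong to [S]. *)
Lemma convex_sum (R : realType) (V : lmodType R) (S : set V) (I : eqType)
    (r : seq I) (c : I -> R) (x : I -> V) :
  convex_set S -> (forall i, 0 <= c i) -> (forall i, 0 < c i -> S (x i)) ->
  0 < \sum_(i <- r) c i ->
  S ((\sum_(i <- r) c i)^-1 *: \sum_(i <- r) c i *: x i).
Proof.
move=> /convex_setP cS c0 xS; elim: r => [|i r IH]; first by rewrite big_nil ltxx.
rewrite !big_cons.
have r0 : 0 <= \sum_(j <- r) c j by apply: sumr_ge0.
have [ci0|ci] := eqVneq (c i) 0.
  by rewrite ci0 scale0r !add0r; exact: IH.
have ci1 : 0 < c i by rewrite lt_neqAle eq_sym ci c0.
set s := \sum_(j <- r) c j in r0 IH *; set v := \sum_(j <- r) _ *: _ in IH *.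
move: r0; rewrite le_eqVlt => /predU1P[s0|s0] _.
  have vE : v = 0.
    move/eqP: s0; rewrite eq_sym psumr_eq0 => [|j _]; last exact: c0.
    rewrite /v; elim: (r) => [|j r' IHr] /=; first by rewrite big_nil.
    by move=> /andP[/eqP cj /IHr]; rewrite big_cons cj scale0r add0r.
  by rewrite -/s -s0 vE !addr0 scalerA mulVf// scale1r; exact: xS.
have t0 : 0 < c i + s by rewrite addr_gt0.
pose t := c i / (c i + s).
have -> : (c i + s)^-1 *: (c i *: x i + v) = t *: x i + (1 - t) *: (s^-1 *: v).
  rewrite scalerDr !scalerA [_^-1 * c i]mulrC; congr (_ + _ *: _).
  by rewrite /t; field; rewrite !gt_eqF.
apply: cS; [exact: xS|exact: IH|].
by rewrite divr_ge0 ?(ltW ci1) ?(ltW t0)//= ler_pdivrMr// mul1r lerDl ltW.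
Qed.

Section AffineExtension.
Context {R : realType} {V : lmodType R} (K : set V).

Lemma A_conv (f : A K) (x y z : K) (t : R) : 0 <= t <= 1 ->
  val z = t *: val x + (1 - t) *: val y -> f z = t * f x + (1 - t) * f y.
Proof. by case: f => f /= /asboolP; exact. Qed.

Lemma A_ext (f g : A K) : (forall x, f x = g x) -> f = g.
Proof. by move=> fg; apply/val_inj/funext. Qed.

Lemma unit_pos : A_pos (unit_fun K).
Proof. by move=> x; rewrite ler01. Qed.

Lemma mixture (x y : K) (t : R) : convex_set K -> 0 <= t <= 1 ->
  exists z : K, val z = t *: val x + (1 - t) *: val y.
Proof.
move=> /convex_setP cK t01.
have zK := mem_set (cK _ _ _ (set_valP x) (set_valP y) t01).
by exists (SigSub zK).
Qed.

(** Jensen's equality for affine functions: the graph of [f] is a convex subset of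
    [V * R], hence contains the mean of its points. *)
Lemma affine_mean (f : A K) (I : eqType) (r : seq I) (c : I -> R) (x : I -> K) :
  convex_set K -> (forall i, 0 <= c i) -> 0 < \sum_(i <- r) c i ->
  exists k : K,
    \sum_(i <- r) c i *: val (x i) = (\sum_(i <- r) c i) *: val k /\
    \sum_(i <- r) c i * f (x i) = (\sum_(i <- r) c i) * f k.
Proof.
move=> cK c0 s0; set s := \sum_(i <- r) c i in s0 *.
pose G : set (V * R^o) := [set (val k, f k : R^o) | k in [set: K]].
have cG : convex_set G.
  apply/convex_setP => _ _ t [k _ <-] [k' _ <-] t01.
  have [z zE] := mixture k k' cK t01.
  by exists z => //; rewrite zE (A_conv f t01 zE).
have xG i : 0 < c i -> G (val (x i), f (x i) : R^o) by exists (x i).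
have [k _ kE] := convex_sum cG c0 xG s0.
have {}kE : (val k, f k : R^o) = s^-1 *: \sum_(i <- r) c i *: (val (x i), f (x i) : R^o) := kE.
exists k; split.
  rewrite -[val k]/((val k, f k : R^o).1) kE /= scalerA divff ?gt_eqF// scale1r.
  by rewrite (raddf_sum fst).
rewrite -[f k]/((val k, f k : R^o).2) kE /=.
rewrite -[s^-1 *: _]/(s^-1 * _) mulrA divff ?gt_eqF// mul1r.
by rewrite (raddf_sum snd).
Qed.

(** The functions in [A K] are affine for convex combinations only; they respect
    all affine combinations that stay in [K], which makes [A K] finite
    dimensional. *)
Lemma affine_combination (f : A K) (I : finType) (x : I -> K) (a : I -> R)
    (y : K) : convex_set K ->
  \sum_i a i = 1 -> val y = \sum_i a i *: val (x i) ->
  f y = \sum_i a i * f (x i).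
Proof.
move=> cK a1 yE.
(* moving the negative coefficients to the other side leaves two means *)
pose p i := (`|a i| + a i) / 2; pose m i := (`|a i| - a i) / 2.
have p0 i : 0 <= p i by rewrite /p; have := ler_norm (- a i); rewrite normrN; lra.
have m0 i : 0 <= m i by rewrite /m; have := ler_norm (a i); lra.
have aE i : a i = p i - m i by rewrite /p /m; lra.
pose r : seq (option I) := None :: map Some (index_enum I).
pose c o := if o is Some i then m i else 1.
pose z o := if o is Some i then x i else y.
have c0 o : 0 <= c o by case: o => //= i; exact: m0.
have sE (W : lmodType R) (g : K -> W) :
    \sum_(o <- r) c o *: g (z o) = g y + \sum_i m i *: g (x i).
  by rewrite big_cons big_map scale1r.
have cE : \sum_(o <- r) c o = 1 + \sum_i m i by rewrite big_cons big_map.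
have pE : \sum_i p i = 1 + \sum_i m i.
  by apply/eqP; rewrite -subr_eq -sumrB -a1; apply/eqP/eq_bigr => i _; rewrite aE.
have S0 : 0 < 1 + \sum_i m i by rewrite ltr_pwDl// sumr_ge0.
have := affine_mean f (r := r) (c := c) z cK c0; rewrite cE => /(_ S0)[k [kV kf]].
have := affine_mean f (r := index_enum I) (c := p) x cK p0.
rewrite pE => /(_ S0)[k' [kV' kf']].
have kk : k = k'.
  apply/val_inj/(scalerI (lt0r_neq0 S0)).
  rewrite -kV -kV' sE yE -big_split; apply: eq_bigr => i _ /=.
  by rewrite -scalerDl; congr (_ *: _); rewrite aE subrK.
have := sE R^o f; rewrite kf kk -kf' => /eqP; rewrite -subr_eq => /eqP <-.
rewrite -sumrB; apply: eq_bigr => i _; rewrite aE mulrBl; congr (_ - _).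
Qed.

End AffineExtension.

(** * Barycentric frames *)

Section Frame.
Context {R : realType} {V : vectType R} (K : set V).

Definition barycentric p (l : 'I_p -> A K) (y : K) : 'rV[R]_p := \row_i l i y.

(** Affine dependence in [V] becomes linear dependence in [V * R]. *)
Definition homogenize (y : K) : V * R^o := (val y, 1).

Lemma maximal_free_points : exists t : seq K,
  free (map homogenize t) /\ forall y, homogenize y \in <<map homogenize t>>%VS.
Proof.
pose P n := `[< exists t : seq K, size t = n /\ free (map homogenize t) >].
have P0 : exists n, P n by exists 0%N; apply/asboolP; exists [::]; split => //; exact: nil_free.
have Pb n : P n -> (n <= \dim {:(V * R^o)%type})%N.
  move=> /asboolP[t [<- /eqP ft]].
  by rewrite -(size_map homogenize t) -ft dimvS// subvf.
case: (ex_maxnP P0 Pb) => n /asboolP[t [tn ft]] nmax.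
exists t; split=> // y; apply/negPn/negP => yt.
have /nmax : P n.+1 by apply/asboolP; exists (y :: t); rewrite /= tn free_cons yt.
by rewrite ltnn.
Qed.

(** A maximal affinely independent family [x] of points of [K], with the
    barycentric coordinates [l] relative to it.  The evaluations at [x] and the
    functions [l] are then dual bases of [A(K)^*] and [A(K)], and the compactness
    of [K] is transported to the image of [K] in coordinate space.  Everything
    else about [K] is derived from this lemma. *)
Lemma barycentric_frame : state_space K ->
  exists p (x : 'I_p -> K) (l : 'I_p -> A K),
    (forall (f : A K) y, f y = \sum_i f (x i) * l i y) /\
    compact (range (barycentric l)).
Proof.
move=> [_ cptK cK].
have [t [ft tspan]] := maximal_free_points.
pose X := [seq homogenize y | y <- t].
pose B := in_tuple X.
pose L i (y : K) : R^o := coord B i (homogenize y).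
have LA i : L i \in @affine R V K.
  apply/asboolP => y z w s s01 E; rewrite /L.
  have -> : homogenize w = s *: homogenize y + (1 - s) *: homogenize z.
    congr (_, _) => //=; rewrite -[RHS]/(s * 1 + (1 - s) * 1); ring.
  by rewrite !linearP !linearZ.
pose l i := AffineFun (LA i).
have xsz (i : 'I_(size X)) : (i < size t)%N by rewrite -(size_map homogenize t).
pose x (i : 'I_(size X)) : K := tnth (in_tuple t) (Ordinal (xsz i)).
have xE (i : 'I_(size X)) : X`_i = homogenize (x i).
  by rewrite /X /x (tnth_nth (x i)) (nth_map (x i)).
have hE y : homogenize y = \sum_i l i y *: homogenize (x i).
  rewrite {1}(coord_span (X := B) (tspan y)); apply: eq_bigr => i _.
  by rewrite -xE.
exists (size X), x, l; split=> [f y|].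
  have := hE y => /[dup] /(congr1 fst) + /(congr1 snd).
  rewrite !raddf_sum /= => y1 y2.
  rewrite (affine_combination f cK (a := fun i => l i y) (x := x))//.
    by apply: eq_bigr => i _; rewrite mulrC.
  rewrite y2; apply: eq_bigr => i _; exact/esym/mulr1.
pose G (r : 'rV[R]_(\dim {:V})) : 'rV[R]_(size X) :=
  \row_i (dot (\row_j coord B i ((vbasis {:V})`_j, 0 : R^o)) r + coord B i (0, 1)).
have -> : range (barycentric l) = G @` (coords @` K).
  have GE (y : K) : barycentric l y = G (coords (val y)).
    apply/rowP => i; rewrite !mxE /= /L.
    have -> : homogenize y = \sum_j coord (vbasis {:V}) j (val y) *:
        ((vbasis {:V})`_j, 0 : R^o) + (0, 1).
      rewrite /homogenize; apply/eqP; rewrite -subr_eq; apply/eqP.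
      apply: injective_projections; rewrite raddf_sum /=.
        by rewrite subr0 -coord_vbasis// memvf.
      by rewrite subrr big1// => j _; rewrite scaler0.
    rewrite linearD linear_sum; congr (_ + _).
    by apply: eq_bigr => j _; rewrite linearZ !mxE mulrC.
  apply/seteqP; split=> [_ [y _ <-]|_ [_ [v Kv <-] <-]].
    by exists (coords (val y)) => //; exists (val y) => //; exact: set_valP.
  by exists (SigSub (mem_set Kv)) => //; rewrite GE.
apply: continuous_compact => //; apply: continuous_subspaceT.
apply: row_continuous => i.
under eq_fun do rewrite mxE.
move=> r; apply: (@continuousD R _ _ (dot _) (fun=> _)).
  exact: dot_continuous.
exact: cst_continuous.
Qed.

End Frame.

(** * Cones, states and constraints *)

Section Cones.
Context {R : realType} {W : vectType R}.

Lemma coords_linear : linear (@coords R W).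
Proof. by move=> a v w; apply/rowP => i; rewrite !mxE linearP. Qed.

HB.instance Definition _ :=
  GRing.isLinear.Build R W 'rV[R]_(\dim {:W}) *:%R (@coords R W) coords_linear.

Lemma coords_inj : injective (@coords R W).
Proof.
move=> v w vw; rewrite (coord_vbasis (memvf v)) (coord_vbasis (memvf w)).
by apply: eq_bigr => i _; move/rowP: vw => /(_ i); rewrite !mxE => ->.
Qed.

(** A point outside [C] is separated from [C] by a hyperplane, and since [C] is a
    cone this hyperplane can be taken through the origin. *)
Lemma bipolar (C : set W) (w : W) : proper_cone C ->
  (forall u, dual_cone C u -> 0 <= u w) -> C w.
Proof.
move=> [[C0 Csc] cC clC _ _] wC; apply: contrapT => nCw.
have cC' : convex_set (coords @` C).
  apply/convex_setP => _ _ t [v Cv <-] [v' Cv' <-] t01.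
  exists (t *: v + (1 - t) *: v'); last by rewrite linearD !linearZ.
  by move/convex_setP: cC; exact.
have nw : ~ (coords @` C) (coords w) by case=> v Cv /coords_inj vw; apply: nCw; rewrite -vw.
have C1 : coords @` C !=set0 by exists (coords 0), 0.
have [u [c [uw uC]]] := strict_separation C1 clC cC' nw.
have uL : (fun v : W => dot u (coords v) : R^o) \in @linear_form R W.
  by apply/asboolP => a v v'; rewrite linearP dotD dotZ.
have c0 : c <= 0 by have := uC _ (ex_intro2 _ _ 0 C0 erefl); rewrite linear0 -(scale0r 0) dotZ mul0r.
suff /wC : dual_cone C (Dual uL) by rewrite /= leNgt (lt_le_trans uw).
move=> v Cv /=; rewrite leNgt; apply/negP => v0.
(* a negative value would be scaled below [c] within the cone *)
have t0 : 0 <= (c - 1) / dot u (coords v).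
  by rewrite -mulrNN -invrN divr_ge0//; lra.
have := uC _ (ex_intro2 _ _ _ (Csc _ _ t0 Cv) erefl).
rewrite linearZ dotZ divfK ?lt_eqF//; lra.
Qed.

Lemma closed_combination (T : topologicalType) n (a : 'I_n -> T -> R)
    (w : 'I_n -> W) (D : set W) :
  (forall i, continuous (a i)) -> closed (coords @` D) ->
  closed [set t | D (\sum_i a i t *: w i)].
Proof.
move=> ac clD.
have gc : continuous (fun t => coords (\sum_i a i t *: w i)).
  apply: row_continuous => j.
  have -> : (fun t => coords (\sum_i a i t *: w i) 0 j) =
      (fun t => \sum_i a i t * coords (w i) 0 j).
    by apply/funext => t; rewrite linear_sum summxE; apply: eq_bigr => i _; rewrite linearZ mxE.
  apply: continuous_sum => i t.
  by apply: (@continuousM R _ _ (fun=> coords (w i) 0 j)); [exact: ac|exact: cst_continuous].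
have -> : [set t | D (\sum_i a i t *: w i)] =
    (fun t => coords (\sum_i a i t *: w i)) @^-1` (coords @` D).
  apply/seteqP; split=> t /= => [Dt|[v Dv /coords_inj <-]//].
  by exists (\sum_i a i t *: w i).
by move/continuous_closedP: gc; exact.
Qed.

End Cones.

Section States.
Context {R : realType} {V : vectType R} (K : set V).

Lemma dual_ext (U : lmodType R) (phi psi : dual U) :
  (forall f, phi f = psi f) -> phi = psi.
Proof. by move=> e; apply/val_inj/funext. Qed.

Lemma dual_sumE (U : lmodType R) (I : Type) (r : seq I) (P : pred I)
    (phi : I -> dual U) f :
  (\sum_(i <- r | P i) phi i) f = \sum_(i <- r | P i) phi i f.
Proof. by elim/big_rec2 : _ => // i u v _ <-. Qed.

Lemma A_sumE (I : Type) (r : seq I) (P : pred I) (f : I -> A K) y :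
  (\sum_(i <- r | P i) f i) y = \sum_(i <- r | P i) f i y.
Proof. by elim/big_rec2 : _ => // i u v _ <-. Qed.

Context p (x : 'I_p -> K) (l : 'I_p -> A K).
Hypothesis frameE : forall (f : A K) y, f y = \sum_i f (x i) * l i y.

Lemma frame_expand (f : A K) : f = \sum_i f (x i) *: l i.
Proof. by apply: A_ext => y; rewrite frameE A_sumE. Qed.

Lemma dual_expand (phi : dual (A K)) : phi = \sum_i phi (l i) *: state (x i).
Proof.
apply: dual_ext => f; rewrite dual_sumE {1}(frame_expand f) linear_sum.
by apply: eq_bigr => i _; rewrite linearZ [RHS]mulrC.
Qed.

Lemma frame_total y : \sum_i l i y = 1.
Proof. by have := frameE (unit_fun K) y => /= ->; apply: eq_bigr => i _; rewrite mul1r. Qed.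

Hypothesis hK : state_space K.
Hypothesis cptl : compact (range (barycentric l)).

Lemma barycentric_inj (phi : dual (A K)) (y : K) :
  (forall i, phi (l i) = l i y) -> phi = state y.
Proof.
by move=> e; rewrite (dual_expand phi) (dual_expand (state y)); apply: eq_bigr => i _; rewrite e.
Qed.

(** The identification of [K] with the normalized positive functionals on [A(K)]:
    if the barycentric coordinates [phi (l i)] were not those of a point of [K], an
    affine function positive on [K] and negative at them would contradict the
    positivity of [phi]. *)
Lemma positive_state (phi : dual (A K)) :
  (forall f, A_pos f -> 0 <= phi f) -> phi (unit_fun K) = 1 ->
  exists y, phi = state y.
Proof.
move=> phi0 phi1; pose r : 'rV[R]_p := \row_i phi (l i).
suff [y _ yr] : range (barycentric l) r.
  by exists y; apply: barycentric_inj => i; move/rowP: yr => /(_ i); rewrite !mxE.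
apply: contrapT => nr.
have [[v Kv] _ cK] := hK.
have C0 : range (barycentric l) !=set0.
  by exists (barycentric l (SigSub (mem_set Kv))), (SigSub (mem_set Kv)).
have cC : convex_set (range (barycentric l)).
  apply/convex_setP => _ _ t [y _ <-] [y' _ <-] t01.
  have [z zE] := mixture y y' cK t01; exists z => //.
  by apply/rowP => i; rewrite !mxE (A_conv _ t01 zE).
have clC : closed (range (barycentric l)).
  exact: compact_closed (@norm_hausdorff _ _) cptl.
have [u [c [ur uC]]] := strict_separation C0 clC cC nr.
pose g : A K := \sum_i u 0 i *: l i - c *: unit_fun K.
have g0 : A_pos g.
  move=> y; have := uC _ (ex_intro2 _ _ y I erefl).
  rewrite -subr_ge0 => /le_trans; apply; rewrite le_eqVlt; apply/orP; left; apply/eqP.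
  rewrite -[g y]/((\sum_i u 0 i *: l i) y - c * 1) A_sumE mulr1; congr (_ - _).
  by apply: eq_bigr => i _; rewrite mxE.
have := phi0 _ g0; rewrite linearB linearZ linear_sum /= phi1 mulr1 subr_ge0 leNgt => /negP; apply.
apply: le_lt_trans ur; rewrite le_eqVlt; apply/orP; left; apply/eqP.
by apply: eq_bigr => i _; rewrite linearZ mxE.
Qed.

Lemma frame_bounded : exists2 M : R, 0 < M & forall i y, `|l i y| <= M.
Proof.
have [M [_ MB]] := compact_bounded cptl.
pose N := `|M| + 1.
have MN : M < N by rewrite /N; have := ler_norm M; lra.
exists N; first by rewrite /N; have := normr_ge0 M; lra.
move=> i y; apply: le_trans (MB _ MN _ (ex_intro2 _ _ y I erefl)).
rewrite [leRHS]/Num.norm /= mx_normrE.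
by apply: (le_trans _ (le_bigmax _ _ (0, i))) => /=; rewrite mxE.
Qed.

(** Linear maps on [A(K)^*] are linear in barycentric coordinates, so the
    constraints cut out a closed part of the compact coordinate image of [K]. *)
Lemma feasible_compact (U W : vectType R) (F : {linear dual (A K) -> U})
    (G : {linear dual (A K) -> W}) (C : set W) : proper_cone C ->
  compact (barycentric l @` [set y | F (state y) = 0 /\ C (G (state y))]).
Proof.
move=> [_ _ clC _ _].
have lin (Z : vectType R) (H : {linear dual (A K) -> Z}) y :
    H (state y) = \sum_i barycentric l y 0 i *: H (state (x i)).
  rewrite {1}(dual_expand (state y)) linear_sum.
  by apply: eq_bigr => i _; rewrite linearZ mxE.
have cl (Z : vectType R) (H : {linear dual (A K) -> Z}) (D : set Z) :
    closed (coords @` D) ->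
    closed [set r : 'rV[R]_p | D (\sum_i r 0 i *: H (state (x i)))].
  by apply: closed_combination => i; exact: coord_continuous.
have cl0 : closed (coords @` [set (0 : U)]).
  by rewrite image_set1; apply: compact_closed; [exact: norm_hausdorff|exact: compact_set1].
have -> : barycentric l @` [set y | F (state y) = 0 /\ C (G (state y))] =
    range (barycentric l) `&` ([set r | [set 0] (\sum_i r 0 i *: F (state (x i)))]
      `&` [set r | C (\sum_i r 0 i *: G (state (x i)))]).
  apply/seteqP; split=> [_ [y [Fy Gy] <-]|_ [[y _ <-] [Fy Gy]]].
    by split; [exists y|split; rewrite /= -lin].
  by exists y => //; split; rewrite lin.
by apply: compact_closedI => //; apply: closedI; apply: cl.
Qed.

End States.

Lemma positive_multiple (R : realType) (V : vectType R) (K : set V) (phi : dual (A K)) :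
  state_space K -> (forall f, A_pos f -> 0 <= phi f) -> 0 < phi (unit_fun K) ->
  exists s : K, phi (unit_fun K) *: state s = phi.
Proof.
move=> hK phi0 t0; set t := phi _ in t0 *.
have [p [x [l [lE lc]]]] := barycentric_frame hK.
have [f f0||s sE] := @positive_state _ _ _ _ _ _ lE hK lc (t^-1 *: phi).
- by rewrite -[X in 0 <= X]/(t^-1 * phi f) mulr_ge0 ?invr_ge0 ?(ltW t0) ?phi0.
- by rewrite -[LHS]/(t^-1 * phi _) mulVf ?gt_eqF.
- by exists s; rewrite -sE scalerA divff ?gt_eqF// scale1r.
Qed.

(** * Norms on the tensor product and informationally complete measurements *)

Section TensorSlices.
Context {R : realType} {U V : lmodType R} (z : tensor U V).

Fact tensor_bilinear :
  (forall v, scalar (fun u => z u v)) /\ (forall u, scalar (z u)).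
Proof. by case: z => h /= /asboolP. Qed.

Fact tensor_slicel_form v : (fun u => z u v) \in @linear_form R U.
Proof. by apply/asboolP; have [] := tensor_bilinear. Qed.

Fact tensor_slicer_form u : (fun v => z u v) \in @linear_form R V.
Proof. by apply/asboolP; have [] := tensor_bilinear. Qed.

Definition tensor_slicel v : dual U := Dual (tensor_slicel_form v).
Definition tensor_slicer u : dual V := Dual (tensor_slicer_form u).

End TensorSlices.

Section TensorExpansion.
Context {R : realType}.

Lemma tensor_ext (U V : lmodType R) (z z' : tensor U V) :
  (forall u v, z u v = z' u v) -> z = z'.
Proof. by move=> e; apply/val_inj/funext => u; apply/funext => v; exact: e. Qed.

Lemma tensor_sumE (U V : lmodType R) (I : Type) (r : seq I) (P : pred I)
    (z : I -> tensor U V) u v :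
  (\sum_(i <- r | P i) z i) u v = \sum_(i <- r | P i) z i u v.
Proof. by elim/big_rec2 : _ => // i s t _ <-. Qed.

Context {VA VB : lmodType R} (KA : set VA) (KB : set VB) (I J : finType).
Context (x : I -> KA) (a : I -> A KA) (y : J -> KB) (b : J -> A KB).
Hypothesis aE : forall f : A KA, f = \sum_i f (x i) *: a i.
Hypothesis bE : forall g : A KB, g = \sum_j g (y j) *: b j.

Lemma tensor_expand (z : tensor (A KA) (A KB)) :
  z = \sum_i \sum_j z (a i) (b j) *: pure (state (x i)) (state (y j)).
Proof.
apply: tensor_ext => f g; rewrite tensor_sumE.
rewrite -[LHS]/(tensor_slicel z g f) {1}(aE f) linear_sum; apply: eq_bigr => i _.
rewrite linearZ tensor_sumE /= -[z (a i) g]/(tensor_slicer z (a i) g).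
rewrite {1}(bE g) linear_sum big_distrr; apply: eq_bigr => j _.
rewrite linearZ /=.
rewrite -[RHS]/(z (a i) (b j) * (f (x i) * g (y j))); ring.
Qed.

End TensorExpansion.

Section Norms.
Context {R : realType} {VA VB : vectType R} (KA : set VA) (KB : set VB).
Hypotheses (hA : state_space KA) (hB : state_space KB).
Let S := max_tensor KA KB.

Lemma pure_state_max (x : KA) (y : KB) : S (pure (state x) (state y)).
Proof.
split=> [f g f0 g0|]; first exact: mulr_ge0 (f0 x) (g0 y).
exact: mulr1.
Qed.

(** Expand the nonnegative values of [z] on the four pairs of positive functions
    [M +- f], [N +- g]: the two mixed terms cancel in suitable sums. *)
Lemma max_tensor_le (z : tensor (A KA) (A KB)) (f : A KA) (g : A KB) M N : S z ->
  (forall x, `|f x| <= M) -> (forall y, `|g y| <= N) -> `|z f g| <= M * N.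
Proof.
move=> [z0 z1] fM gN.
pose u := unit_fun KA; pose v := unit_fun KB.
have fp : A_pos (M *: u + f) /\ A_pos (M *: u - f).
  by split=> x; have := fM x; rewrite ler_norml => /andP[];
    [rewrite -[X in 0 <= X]/(M * 1 + f x)|rewrite -[X in 0 <= X]/(M * 1 - f x)]; lra.
have gp : A_pos (N *: v + g) /\ A_pos (N *: v - g).
  by split=> x; have := gN x; rewrite ler_norml => /andP[];
    [rewrite -[X in 0 <= X]/(N * 1 + g x)|rewrite -[X in 0 <= X]/(N * 1 - g x)]; lra.
have zE s t : z (M *: u + s *: f) (N *: v + t *: g) =
    M * N + M * t * z u g + s * N * z f v + s * t * z f g.
  rewrite -[LHS]/(tensor_slicel z _ (M *: u + s *: f)) linearD !linearZ /=.
  rewrite -![z _ (N *: v + _)]/(tensor_slicer z _ (N *: v + t *: g)).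
  rewrite !linearD !linearZ /= -/u -/v (z1 : z u v = 1); ring.
have [fp1 fp2] := fp; have [gp1 gp2] := gp.
have h1 := z0 _ _ fp1 gp1; have h2 := z0 _ _ fp1 gp2.
have h3 := z0 _ _ fp2 gp1; have h4 := z0 _ _ fp2 gp2.
move: h1 h2 h3 h4; rewrite -[f]scale1r -[g]scale1r -!scaleNr !zE !scale1r.
rewrite ler_norml; lra.
Qed.

(** The infimum that defines [unit_norm] is a bound on [S]; what has to be shown is
    that some bound exists, which holds because [S] has bounded coordinates. *)
Lemma unit_norm_ub (g : dual (tensor (A KA) (A KB))) z : S z ->
  `|g z| <= unit_norm S g.
Proof.
have [p [x [l [lE lc]]]] := barycentric_frame hA.
have [q [y [m [mE mc]]]] := barycentric_frame hB.
have [M M0 lM] := frame_bounded lc.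
have [N N0 mN] := frame_bounded mc.
move=> Sz; apply: lb_le_inf => [|t [t0 /(_ z Sz)]]; last by rewrite ler_norml.
pose B := \sum_i \sum_j M * N * `|g (pure (state (x i)) (state (y j)))|.
have B0 : 0 <= B.
  by do 2!(apply: sumr_ge0 => ? _); rewrite !mulr_ge0// ltW.
exists B; split=> // w Sw; rewrite -ler_norml.
rewrite (tensor_expand (frame_expand lE) (frame_expand mE) w) linear_sum.
apply: le_trans (ler_norm_sum _ _ _) _; apply: ler_sum => i _.
rewrite linear_sum; apply: le_trans (ler_norm_sum _ _ _) _.
apply: ler_sum => j _; rewrite linearZ normrM ler_wpM2r//.
exact: max_tensor_le.
Qed.

(** In the expansion of [z] along two frames the basis tensors are product states,
    which belong to [S].  Thus the base norm is controlled by the table of values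
    of [z] on the frame functions. *)
Lemma dual_tensor_le (I J : finType) (x : I -> KA) (a : I -> A KA)
    (y : J -> KB) (b : J -> A KB) (g : dual (tensor (A KA) (A KB))) z :
  (forall f : A KA, f = \sum_i f (x i) *: a i) ->
  (forall f : A KB, f = \sum_j f (y j) *: b j) ->
  `|g z| <= unit_norm S g * \sum_i \sum_j `|z (a i) (b j)|.
Proof.
move=> aE bE; rewrite {1}(tensor_expand aE bE z) linear_sum mulr_sumr.
apply: le_trans (ler_norm_sum _ _ _) _; apply: ler_sum => i _.
rewrite linear_sum mulr_sumr; apply: le_trans (ler_norm_sum _ _ _) _.
apply: ler_sum => j _; rewrite linearZ normrM mulrC ler_wpM2r//.
exact: unit_norm_ub (pure_state_max _ _).
Qed.

Lemma base_norm_le (z : tensor (A KA) (A KB)) (c : R) : 0 <= c ->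
  (forall g : dual (tensor (A KA) (A KB)), `|g z| <= unit_norm S g * c) -> base_norm S z <= c.
Proof.
move=> c0 gc; apply: sup_le_ub => [|_ [g g1 <-]].
  exists `|(0 : dual _) z|, 0 => //=.
  apply: le_trans ler01; apply: ge_inf; first by exists 0 => t [].
  by split=> // w _; rewrite oppr0 lexx.
apply: le_trans (gc g) _.
by rewrite -[leRHS]mul1r ler_wpM2r.
Qed.

End Norms.

(** An informationally complete measurement: the effects [M +- l i], suitably
    scaled, are positive and add up to the unit, and the differences
    [(M + l i) - (M - l i)] recover the frame [l]. *)
Lemma measurement_exists (R : realType) (V : vectType R) (K : set V) :
  state_space K -> exists (J : finType) (e : J -> A K) (y : J -> K) (c : J -> R),
    [/\ forall j, A_pos (e j), \sum_j e j = unit_fun K &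
        forall g : A K, g = \sum_j g (y j) *: (c j *: e j)].
Proof.
move=> hK; have [p [x [l [lE lc]]]] := barycentric_frame hK.
have [M M0 lM] := frame_bounded lc.
have [[v Kv] _ _] := hK.
have p0 : (0 < p)%N.
  case: p x l lE lc lM => // x l lE lc lM.
  by have /eqP := frame_total lE (SigSub (mem_set Kv)); rewrite big_ord0 eq_sym oner_eq0.
pose s (b : bool) : R := if b then -1 else 1.
pose k : R := (2 * p%:R * M)^-1.
have pR : 0 < p%:R :> R by rewrite ltr0n.
have k0 : 0 < k by rewrite invr_gt0 !mulr_gt0.
pose e (j : 'I_p * bool) : A K := k *: (M *: unit_fun K + s j.2 *: l j.1).
have eE j z : e j z = k * (M + s j.2 * l j.1 z).
  by rewrite -[LHS]/(k * (M * 1 + s j.2 * l j.1 z)) mulr1.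
exists ('I_p * bool)%type, e, (fun j => x j.1), (fun j => s j.2 * (p%:R * M)); split.
- move=> [i b] z; rewrite eE mulr_ge0 ?(ltW k0)//=.
  have := lM i z; rewrite ler_norml => /andP[] ? ?; rewrite /s; case: b; lra.
- apply: A_ext => z; rewrite A_sumE.
  rewrite (eq_bigr (fun j => k * (M + s j.2 * l j.1 z))) => [|j _]; last exact: eE.
  rewrite -(pair_bigA _ (fun i b => k * (M + s b * l i z))) /=.
  rewrite (eq_bigr (fun=> (p%:R : R)^-1)) => [|i _].
    by rewrite sumr_const card_ord -[LHS]mulr_natr mulVf ?gt_eqF.
  by rewrite big_bool /s /k /=; field; rewrite !gt_eqF.
- move=> g; rewrite {1}(frame_expand lE g).
  rewrite -(pair_bigA _ (fun i b => g (x i) *: (s b * (p%:R * M) *: e (i, b)))) /=.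
  apply: eq_bigr => i _; rewrite big_bool /= -scalerDr; congr (_ *: _).
  apply: A_ext => z.
  rewrite -[RHS]/(s true * (p%:R * M) * e (i, true) z + s false * (p%:R * M) * e (i, false) z).
  by rewrite !eE /s /k /=; field; rewrite !gt_eqF.
Qed.

(** * Measuring the copies of B *)

Lemma perm_eq_nth (T : eqType) (x0 : T) (n : nat) (s t : seq T) :
  perm_eq s t -> size s = n ->
  exists p : 'S_n, forall i : 'I_n, nth x0 s i = nth x0 t (p i).
Proof.
move=> st sn; have tn : size t = n by rewrite -(perm_size st).
have : perm_eq (tcast sn (in_tuple s)) (tcast tn (in_tuple t)) by rewrite !val_tcast.
move=> /tuple_permP[p pE]; exists p => i.
have -> : s = tcast sn (in_tuple s) by rewrite val_tcast.
by rewrite pE -tnth_nth tnth_mktuple (tnth_nth x0) val_tcast.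
Qed.

Lemma nth_pad (T : Type) (x0 : T) (s : seq T) m i :
  nth x0 (s ++ nseq m x0) i = nth x0 s i.
Proof.
rewrite nth_cat; case: ltnP => // si.
by rewrite nth_nseq if_same nth_default.
Qed.

Section Effects.
Context {R : realType} {VA VB : lmodType R} {KA : set VA} {KB : set VB}.
Context {n : nat} (y : ntensor (A KA) (A KB) n.+1).

Local Notation u := (unit_fun KA).
Local Notation v := (unit_fun KB).

(** For effects, the probability of observing [f] on A together with the effects of
    the list [s] on distinct copies of B, the other copies being ignored.  By
    symmetry it does not matter which copies are used, so that the list alone
    serves as an index. *)
Definition joint (f : A KA) (s : seq (A KB)) : R := y f (fun i => nth v s i).

(** The entry at position [0] is a placeholder that [slicer] overwrites. *)
Definition head_arg (s : seq (A KB)) : 'I_n.+1 -> A KB := fun i => nth v (v :: s) i.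

Lemma joint_slicel f s : joint f s = slicel y (fun i => nth v s i) f.
Proof. by []. Qed.

Lemma joint_slicer f g s : joint f (g :: s) = slicer y f (head_arg s) ord0 g.
Proof.
congr (y f _); apply/funext => i /=; rewrite /head_arg.
by case: eqVneq => [->|] //; case: i => -[].
Qed.

Hypothesis ymax : max_ntensor KA KB n.+1 y.
Hypothesis ysym : forall (s : 'S_n.+1) f g, y f (fun i => g (s i)) = y f g.

Lemma joint_perm f s t : perm_eq s t -> (size s <= n.+1)%N -> joint f s = joint f t.
Proof.
move=> st sn; pose m := (n.+1 - size s)%N.
have st' : perm_eq (s ++ nseq m v) (t ++ nseq m v) by rewrite perm_cat2r.
have sz : size (s ++ nseq m v) = n.+1 by rewrite size_cat size_nseq subnKC.
have [p pE] := perm_eq_nth v st' sz.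
rewrite /joint -[RHS](ysym p); congr (y f _); apply/funext => i.
by rewrite -(nth_pad v s m) pE nth_pad.
Qed.

Lemma joint_unit f s : (size s <= n)%N -> joint f (v :: s) = joint f s.
Proof.
move=> sn; have vs : perm_eq (v :: s) (rcons s v) by rewrite perm_sym perm_rcons.
rewrite (joint_perm f vs)// /joint; congr (y f _); apply/funext => i.
by have := nth_pad v s 1 i; rewrite cats1.
Qed.

Lemma joint_total (J : finType) (e : J -> A KB) f s : \sum_j e j = v ->
  (size s <= n)%N -> \sum_j joint f (e j :: s) = joint f s.
Proof.
move=> e1 sn; rewrite -[RHS]joint_unit// -e1 joint_slicer linear_sum.
by apply: eq_bigr => j _; rewrite joint_slicer.
Qed.

(** No-signalling from the copy measured by [e] to the one carrying [g]. *)
Lemma joint_total2 (J : finType) (e : J -> A KB) f g s : \sum_j e j = v ->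
  (size s < n)%N -> \sum_j joint f (g :: e j :: s) = joint f (g :: s).
Proof.
move=> e1 sn; rewrite -(joint_total (e := e))//; apply: eq_bigr => j _.
apply: joint_perm; last exact: sn.
by apply/seq.permP => P /=; rewrite addnCA.
Qed.

Lemma joint_ge0 f s : A_pos f -> {in s, forall g, A_pos g} -> 0 <= joint f s.
Proof.
move=> f0 s0; apply: ymax.1 => // i.
have [is_|si] := ltnP i (size s); first by apply/s0/mem_nth.
by rewrite nth_default//; exact: unit_pos.
Qed.

Lemma joint_unit_nil : joint u [::] = 1.
Proof. by rewrite -[RHS]ymax.2 /joint; congr (y u _); apply/funext => i; rewrite nth_nil. Qed.

Lemma joint_le M (f : A KA) s : (forall x, `|f x| <= M) -> {in s, forall g, A_pos g} ->
  `|joint f s| <= M * joint u s.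
Proof.
move=> fM s0.
have h1 : A_pos (M *: u + f).
  by move=> x; have := fM x; rewrite ler_norml -[X in _ -> 0 <= X]/(M * 1 + f x); lra.
have h2 : A_pos (M *: u - f).
  by move=> x; have := fM x; rewrite ler_norml -[X in _ -> 0 <= X]/(M * 1 - f x); lra.
have := joint_ge0 h1 s0; have := joint_ge0 h2 s0.
rewrite !joint_slicel linearB linearD !linearZ /= ler_norml; lra.
Qed.

Section Measured.
Context {J : finType} (e : J -> A KB).
Hypotheses (e0 : forall j, A_pos (e j)) (e1 : \sum_j e j = v).

(** The outcomes of measuring [e] on [k] copies of B, each outcome being recorded
    as the list of the observed effects. *)
Fixpoint words (k : nat) : seq (seq (A KB)) :=
  if k is k'.+1 then [seq e j :: b | b <- words k', j <- index_enum J] else [:: [::]].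

Lemma words_size k b : b \in words k -> size b = k.
Proof.
elim: k b => [|k IH] b /=; first by rewrite inE => /eqP ->.
by move=> /allpairsP[[b' j] /= [/IH <- _ ->]].
Qed.

Lemma words_pos k b : b \in words k -> {in b, forall g, A_pos g}.
Proof.
elim: k b => [|k IH] b /=; first by rewrite inE => /eqP -> g; rewrite in_nil.
move=> /allpairsP[[b' j] /= [/IH b'0 _ ->]] g.
by rewrite inE => /predU1P[->|/b'0].
Qed.

Lemma words_sum k (F : seq (A KB) -> R) :
  \sum_(b <- words k.+1) F b = \sum_(b <- words k) \sum_j F (e j :: b).
Proof. by rewrite big_allpairs_dep. Qed.

Lemma words_joint k f : (k <= n.+1)%N -> \sum_(b <- words k) joint f b = joint f [::].
Proof.
elim: k => [|k IH] kn; first by rewrite big_seq1.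
rewrite words_sum -(IH (ltnW kn)) big_seq [RHS]big_seq; apply: eq_bigr => b bk.
by rewrite joint_total ?(words_size bk).
Qed.

Lemma words_joint2 k f g : (k <= n)%N ->
  \sum_(b <- words k) joint f (g :: b) = joint f [:: g].
Proof.
elim: k => [|k IH] kn; first by rewrite big_seq1.
rewrite words_sum -(IH (ltnW kn)) big_seq [RHS]big_seq; apply: eq_bigr => b bk.
by rewrite joint_total2 ?(words_size bk).
Qed.

(** The second moment of the posterior expectation [joint f b / joint u b] of [f]
    given the outcome [b].  Posterior expectations form a martingale in [k], so
    the moments increase with [k]. *)
Definition moment k f : R := \sum_(b <- words k) joint f b ^+ 2 / joint u b.

(** The difference between the true probability of [f] and [e j] after the outcome
    [b] and the one predicted by independence, weighted by the probability of
    [b]. *)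
Definition deviation f (j : J) b : R :=
  joint f (e j :: b) - joint f b / joint u b * joint u (e j :: b).

(** [F j / p j] is a random variable with mean [Q / P] under the weights [p]: this
    is the formula for its variance, with division by zero giving zero. *)
Lemma variance_step (p F : J -> R) (P Q : R) :
  (forall j, p j = 0 -> F j = 0) -> (P = 0 -> Q = 0) ->
  \sum_j p j = P -> \sum_j F j = Q ->
  \sum_j (F j - Q / P * p j) ^+ 2 / p j = \sum_j F j ^+ 2 / p j - Q ^+ 2 / P.
Proof.
move=> pF PQ pP FQ.
rewrite (eq_bigr (fun j => F j ^+ 2 / p j - 2 * (Q / P) * F j + (Q / P) ^+ 2 * p j)).
  rewrite big_split sumrB -!mulr_sumr pP FQ /=.
  have [P0|P0] := eqVneq P 0; last by field.
  by rewrite P0 (PQ P0) invr0; ring.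
move=> j _; move: (Q / P) => q.
have [p0|p0] := eqVneq (p j) 0; last by field.
by rewrite p0 (pF _ p0) invr0; ring.
Qed.

Lemma moment_step k (f : A KA) (M : R) : (k <= n)%N -> (forall x, `|f x| <= M) ->
  moment k.+1 f - moment k f =
  \sum_(b <- words k) \sum_j deviation f j b ^+ 2 / joint u (e j :: b).
Proof.
move=> kn fM; rewrite /moment words_sum -sumrB big_seq [RHS]big_seq.
apply: eq_bigr => b bk; have bs := words_size bk.
have zero s : {in s, forall g, A_pos g} -> joint u s = 0 -> joint f s = 0.
  move=> s0 us; apply/eqP; rewrite -normr_le0.
  by apply: le_trans (joint_le fM s0) _; rewrite us mulr0.
apply/esym; apply: variance_step.
- move=> j; apply: zero => g; rewrite inE => /predU1P[->//|].
  exact: words_pos bk g.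
- exact/zero/(words_pos bk).
- by rewrite joint_total ?bs.
- by rewrite joint_total ?bs.
Qed.

Lemma moment_ge0 k f : 0 <= moment k f.
Proof.
rewrite /moment big_seq; apply: sumr_ge0 => b bk.
by rewrite divr_ge0 ?sqr_ge0// joint_ge0 ?unit_pos//; exact: words_pos bk.
Qed.

Lemma moment_le k (f : A KA) (M : R) : 0 <= M -> (k <= n.+1)%N -> (forall x, `|f x| <= M) ->
  moment k f <= M ^+ 2.
Proof.
move=> M0 kn fM.
have -> : M ^+ 2 = \sum_(b <- words k) M ^+ 2 * joint u b.
  by rewrite -mulr_sumr words_joint// joint_unit_nil mulr1.
rewrite /moment big_seq [leRHS]big_seq; apply: ler_sum => b bk.
have b0 := words_pos bk; have := joint_le fM b0.
have [u0 _|u0 le] := eqVneq (joint u b) 0; first by rewrite u0 invr0 !mulr0.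
have up : 0 < joint u b by rewrite lt_neqAle eq_sym u0 joint_ge0//; exact: unit_pos.
rewrite ler_pdivrMr// -mulrA -expr2 -exprMn -real_normK ?num_real//.
by rewrite ler_sqr ?nnegrE// mulr_ge0// ltW.
Qed.

(** The inequality of arithmetic and geometric means, applied to each term with the
    parameter [eps], plays the part of the Cauchy-Schwarz inequality. *)
Lemma deviation_le k (f : A KA) (M eps : R) : (k <= n)%N -> (forall x, `|f x| <= M) -> 0 < eps ->
  \sum_(b <- words k) \sum_j `|deviation f j b| <=
  (eps + (moment k.+1 f - moment k f) / eps) / 2.
Proof.
move=> kn fM eps0; rewrite (moment_step kn fM).
have epsE : eps = \sum_(b <- words k) \sum_j eps * joint u (e j :: b).
  rewrite -(words_sum k (fun b => eps * joint u b)) -mulr_sumr.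
  by rewrite words_joint// joint_unit_nil mulr1.
rewrite [X in (X + _) / _]epsE mulr_suml -big_split mulr_suml.
rewrite big_seq [leRHS]big_seq; apply: ler_sum => b bk.
rewrite mulr_suml -big_split mulr_suml; apply: ler_sum => j _ /=.
have s0 : {in e j :: b, forall g, A_pos g}.
  by move=> g; rewrite inE => /predU1P[->//|]; exact: words_pos bk g.
have p0 := joint_ge0 (@unit_pos _ _ _) s0; have fp := joint_le fM s0.
have dp : joint u (e j :: b) = 0 -> deviation f j b = 0.
  move=> u0; move: fp; rewrite /deviation u0 !mulr0 normr_le0 => /eqP ->.
  exact: subrr.
move: (joint u _) (deviation _ _ _) p0 dp => p d; rewrite le_eqVlt => /predU1P[<- dp|p0 _].
  by rewrite dp// normr0 expr0n !(mulr0, mul0r, addr0).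
have ep : 0 < eps * p by rewrite mulr_gt0.
have -> : eps * p + d ^+ 2 / p / eps = ((eps * p) ^+ 2 + `|d| ^+ 2) / (eps * p).
  by rewrite real_normK ?num_real//; field; rewrite !gt_eqF.
rewrite -mulrA -invfM ler_pdivlMr ?mulr_gt0//.
have := sqr_ge0 (eps * p - `|d|); lra.
Qed.

(** The moments of [a i] increase by at most [M ^+ 2] in the first [n.+1] steps, so
    that in one of these steps the total increase over [i] is at most
    [#|I| * M ^+ 2 / n.+1]. *)
Lemma posterior_stabilizes (I : finType) (a : I -> A KA) (M : R) : 0 < M ->
  (forall i x, `|a i x| <= M) ->
  exists2 k, (k <= n)%N &
    \sum_i \sum_(b <- words k) \sum_j `|deviation (a i) j b| <=
    #|I|%:R * M / Num.sqrt n.+1%:R.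
Proof.
move=> M0 aM; pose N : R := n.+1%:R.
have N0 : 0 < N by rewrite ltr0n.
pose D k := \sum_i (moment k.+1 (a i) - moment k (a i)).
have [k kn Dk] : exists2 k, (k <= n)%N & D k <= #|I|%:R * M ^+ 2 / N.
  apply: contrapT => nk.
  have : \sum_(0 <= k < n.+1) #|I|%:R * M ^+ 2 / N < \sum_(0 <= k < n.+1) D k.
    apply: ltr_sum_nat => // k kn; rewrite ltNge; apply/negP => Dk.
    by apply: nk; exists k.
  rewrite sumr_const_nat subn0 -[X in X < _]mulr_natr divfK ?gt_eqF// ltNge.
  move=> /negP; apply; rewrite exchange_big /= mulr_natl -sumr_const.
  apply: ler_sum => i _; rewrite telescope_sumr// lerBlDr.
  apply: le_trans (moment_le (ltW M0) (leqnn _) (aM i)) _.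
  by rewrite lerDl moment_ge0.
(* the choice of [eps] that balances the two terms of [deviation_le] *)
exists k => //; pose eps := M / Num.sqrt N.
have sN : 0 < Num.sqrt N by rewrite sqrtr_gt0.
have eps0 : 0 < eps by rewrite divr_gt0.
have eps2 : eps ^+ 2 = M ^+ 2 / N by rewrite expr_div_n sqr_sqrtr ?ltW.
have -> : #|I|%:R * M / Num.sqrt n.+1%:R = #|I|%:R * eps by rewrite mulrA.
clearbody eps.
apply: le_trans (ler_sum _ (fun i _ => deviation_le kn (aM i) eps0)) _.
rewrite -mulr_suml big_split /= sumr_const -mulr_suml -/(D k) -[eps *+ _]mulr_natl.
rewrite ler_pdivrMr// mulrDr mulr1 lerD2l ler_pdivrMr//.
by rewrite -mulrA -expr2 eps2 mulrA.
Qed.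

End Measured.
End Effects.

(** * The de Finetti decomposition *)

Section Decomposition.
Context {R : realType} {VA VB : vectType R} (KA : set VA) (KB : set VB).
Hypotheses (hA : state_space KA) (hB : state_space KB).

(** The two unnormalized states are obtained from [y] by applying effects to all
    factors but one.  The constraints on [y] are stated for such slices, hence they
    pass to the conditional states. *)
Definition conditional n (y : ntensor (A KA) (A KB) n.+1) (w : R) (s : KA * KB) : Prop :=
  (exists2 g, (forall j, A_pos (g j)) & w *: state s.1 = slicel y g) /\
  (exists2 g, (forall j, A_pos (g j)) &
    w *: state s.2 = slicer y (unit_fun KA) g ord0).

Lemma conditional_exists n (y : ntensor (A KA) (A KB) n.+1) (b : seq (A KB)) :
  max_ntensor KA KB n.+1 y ->
  (forall (s : 'S_n.+1) f g, y f (fun i => g (s i)) = y f g) ->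
  (size b <= n)%N -> {in b, forall g, A_pos g} -> 0 < joint y (unit_fun KA) b ->
  exists s : KA * KB, [/\ conditional y (joint y (unit_fun KA) b) s,
    forall f : A KA, joint y (unit_fun KA) b * f s.1 = joint y f b &
    forall g : A KB, joint y (unit_fun KA) b * g s.2 = joint y (unit_fun KA) (g :: b)].
Proof.
move=> ymax ysym bn b0 w0; set w := joint _ _ _ in w0 *.
have [f f0|//|s sE] := positive_multiple (phi := slicel y (fun i => nth (unit_fun KB) b i)) hA.
  exact: (joint_ge0 ymax f0 b0).
have wE : slicer y (unit_fun KA) (head_arg b) ord0 (unit_fun KB) = w.
  by rewrite -joint_slicer joint_unit.
have [g g0||t tE] := positive_multiple (phi := slicer y (unit_fun KA) (head_arg b) ord0) hB.
- rewrite -joint_slicer; apply: (joint_ge0 ymax (@unit_pos _ _ _)) => h.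
  by rewrite inE => /predU1P[->//|]; exact: b0.
- by rewrite wE.
rewrite wE in tE; exists (s, t); split.
- split; [exists (fun i => nth (unit_fun KB) b i)|exists (head_arg b)] => // j.
    have [jb|jb] := ltnP j (size b); first exact/b0/mem_nth.
    by rewrite nth_default//; exact: unit_pos.
  rewrite /head_arg; have [jb|jb] := ltnP j (size (unit_fun KB :: b)).
    have := mem_nth (unit_fun KB) jb; rewrite inE => /predU1P[->|]; last exact: b0.
    exact: unit_pos.
  by rewrite nth_default//; exact: unit_pos.
- by move=> f; have /(congr1 (fun h : dual (A KA) => h f)) := sE.
- by move=> g; rewrite joint_slicer -tE.
Qed.

(** Measure [k] of the copies of B, with [k] such that one further measurement
    hardly changes the knowledge about A.  Given the outcome [b], A and the next
    copy of B are then nearly independent, and [x] is close to the mixture over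
    [b] of the products of the conditional states. *)
Lemma de_finetti : exists2 c : R, 0 <= c &
  forall n (x : tensor (A KA) (A KB)) (y : ntensor (A KA) (A KB) n.+1),
  extension x y ->
  exists (r : seq (seq (A KB))) (w : seq (A KB) -> R) (s : seq (A KB) -> KA * KB),
    [/\ forall b, 0 <= w b, forall b, 0 < w b -> conditional y (w b) (s b),
        \sum_(b <- r) w b = 1 &
        forall g : dual (tensor (A KA) (A KB)),
          `|g (\sum_(b <- r) w b *: pure (state (s b).1) (state (s b).2) - x)| <=
          unit_norm (max_tensor KA KB) g * (2 * c / Num.sqrt n.+1%:R)].
Proof.
have [p [a [l [lE lc]]]] := barycentric_frame hA.
have [M M0 lM] := frame_bounded lc.
have [J [e [yJ [c [e0 e1 eE]]]]] := measurement_exists hB.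
pose mu : R := \sum_j `|c j|.
have mu0 : 0 <= mu by apply: sumr_ge0.
have cmu j : `|c j| <= mu by rewrite /mu (bigD1 j)//= lerDl sumr_ge0.
exists (mu * (p%:R * M) / 2); first by rewrite !mulr_ge0// ltW.
move=> n x y [ymax ysym xE].
have [k kn kle] := posterior_stabilizes ymax ysym e0 e1 M0 lM.
pose u := unit_fun KA.
pose w b := if b \in words e k then joint y u b else 0.
have wE b : b \in words e k -> w b = joint y u b by rewrite /w => ->.
have w0 b : 0 <= w b.
  rewrite /w; case: ifPn => // bk.
  by apply: (joint_ge0 ymax (@unit_pos _ _ _)); exact: words_pos bk.
have [v0 Kv0] : KA !=set0 by case: hA.
have [v1 Kv1] : KB !=set0 by case: hB.
have /choice[s sP] : forall b, exists s : KA * KB, 0 < w b ->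
    [/\ conditional y (w b) s, forall f : A KA, w b * f s.1 = joint y f b &
        forall g : A KB, w b * g s.2 = joint y u (g :: b)].
  move=> b; case: (boolP (b \in words e k)) => bk; last first.
    by exists (SigSub (mem_set Kv0), SigSub (mem_set Kv1)); rewrite /w (negbTE bk) ltxx.
  have [wb|wb] := ltP 0 (w b); last first.
    by exists (SigSub (mem_set Kv0), SigSub (mem_set Kv1)).
  rewrite (wE b bk) in wb *.
  have bn : (size b <= n)%N by rewrite (words_size bk).
  have [s' ?] := conditional_exists ymax ysym bn (words_pos e0 bk) wb.
  by exists s'.
exists (words e k), w, s; split=> // [b /sP[]//||g].
  rewrite -[RHS](joint_unit_nil ymax) -(words_joint ysym e1 u (leqW kn)).
  by rewrite big_seq [RHS]big_seq; apply: eq_bigr => b; exact: wE.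
set z := _ - x.
(* on frame and measurement effects, the error is the sum of the deviations *)
have zE f j : z f (e j) = - \sum_(b <- words e k) deviation y e f j b.
  rewrite -[LHS]/((\sum_(b <- words e k) w b *: pure (state (s b).1) (state (s b).2)) f (e j) - x f (e j)).
  have -> : x f (e j) = joint y f [:: e j].
    by rewrite xE; congr (y f _); apply/funext => -[[|i] ?] //=; rewrite nth_nil.
  rewrite -(words_joint2 ysym e1 f (e j) kn) tensor_sumE -sumrB -sumrN.
  rewrite big_seq [RHS]big_seq; apply: eq_bigr => b bk.
  rewrite /deviation opprB; congr (_ - _).
  rewrite -[LHS]/(w b * (f (s b).1 * e j (s b).2)) -wE//.
  have [wb|wb] := ltP 0 (w b).
    have [_ <- <-] := sP b wb; field; exact: lt0r_neq0.
  have -> : w b = 0 by apply/eqP; rewrite eq_le wb w0.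
  by rewrite invr0 mulr0 !mul0r.
clearbody z.
have u0 : 0 <= unit_norm (max_tensor KA KB) g.
  by apply: le_trans (unit_norm_ub hA hB g (pure_state_max (SigSub (mem_set Kv0)) (SigSub (mem_set Kv1)))).
apply: le_trans (dual_tensor_le hA hB g z (frame_expand lE) eE) _.
apply: ler_wpM2l => //.
have -> : 2 * (mu * (p%:R * M) / 2) / Num.sqrt n.+1%:R =
    mu * (#|'I_p|%:R * M / Num.sqrt n.+1%:R).
  by rewrite card_ord; field; rewrite gt_eqF// sqrtr_gt0.
apply: le_trans (ler_wpM2l mu0 kle).
rewrite mulr_sumr; apply: ler_sum => i _.
rewrite exchange_big /= mulr_sumr; apply: ler_sum => j _.
have -> : z (l i) (c j *: e j) = c j * z (l i) (e j).
  by rewrite -[LHS]/(tensor_slicer z (l i) (c j *: e j)) linearZ.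
rewrite zE normrM normrN.
by apply: ler_pM => //; exact: ler_norm_sum.
Qed.

End Decomposition.

(** * The constrained bilinear problem *)

Section ProductExtension.
Context {R : realType} {VA VB : lmodType R} {KA : set VA} {KB : set VB}.
Context (x : KA) (y : KB) (n : nat).

Let power (f : A KA) (g : 'I_n -> A KB) : R^o := f x * \prod_i g i y.

Lemma prod_slot (g : 'I_n -> A KB) i (h : A KB) :
  \prod_j ([eta g with i |-> h] j) y = h y * \prod_(j | j != i) g j y.
Proof.
rewrite (bigD1 i)//= eqxx; congr (_ * _).
by apply: eq_bigr => j /negbTE ->.
Qed.

Fact power_scalarl g : scalar (fun f => power f g).
Proof. by move=> a f f'; rewrite /power -[(a *: f + f') x]/(a * f x + f' x) mulrDl mulrA. Qed.

Fact power_scalarr f g i : scalar (fun h => power f [eta g with i |-> h]).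
Proof.
move=> a h h'; rewrite /power !prod_slot -[(a *: h + h') y]/(a * h y + h' y).
ring.
Qed.

Definition power_state : ntensor (A KA) (A KB) n :=
  NTensor power_scalarl power_scalarr.

Lemma slicel_power g : slicel power_state g = (\prod_i g i y) *: state x.
Proof. by apply: dual_ext => f; rewrite -[LHS]/(power f g) /power mulrC. Qed.

Lemma slicer_power f g i :
  slicer power_state f g i = (f x * \prod_(j | j != i) g j y) *: state y.
Proof.
by apply: dual_ext => h; rewrite -[LHS]/(power f _) /power prod_slot mulrCA mulrC.
Qed.

End ProductExtension.

Lemma power_extension (R : realType) (VA VB : lmodType R) (KA : set VA)
    (KB : set VB) (x : KA) (y : KB) n :
  extension (pure (state x) (state y)) (power_state x y n.+1).
Proof.
split.
- split=> [f g f0 g0|].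
    by apply: mulr_ge0 (f0 x) _; apply: prodr_ge0 => i _; exact: g0.
  by rewrite -[LHS]/(1 * \prod_(i < n.+1) 1) mul1r big1.
- move=> s f g; congr (_ * _); rewrite [RHS](reindex_inj (@perm_inj _ s)).
  by apply: eq_bigr.
- move=> f g; congr (_ * _); rewrite big_ord_recl /= big1 ?mulr1// => i _.
Qed.

Lemma min_tensor_sum (R : realType) (VA VB : lmodType R) (KA : set VA)
    (KB : set VB) (I : eqType) (r : seq I) (w : I -> R) (s : I -> KA * KB) :
  (forall i, 0 <= w i) -> \sum_(i <- r) w i = 1 ->
  min_tensor KA KB (\sum_(i <- r) w i *: pure (state (s i).1) (state (s i).2)).
Proof.
move=> w0 w1 S [cS pS].
have := convex_sum (r := r) (c := w) (x := fun i => pure (state (s i).1) (state (s i).2)) cS w0.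
rewrite w1 invr1 scale1r => h; apply: h => [i _|]; last exact: ltr01.
by apply: pS; exists (s i).
Qed.

Section Optimization.
Context {R : realType} {VA VB UA UB WA WB : vectType R}.
Context (KA : set VA) (KB : set VB) (CA : set WA) (CB : set WB).
Context (FA : {linear dual (A KA) -> UA}) (FB : {linear dual (A KB) -> UB}).
Context (GA : {linear dual (A KA) -> WA}) (GB : {linear dual (A KB) -> WB}).
Hypotheses (hA : state_space KA) (hB : state_space KB).
Hypotheses (hCA : proper_cone CA) (hCB : proper_cone CB).

Local Notation feas := (feasible FA FB GA CA GB CB).

(** The symmetric power of [s.2] extends the product state, so every feasible point
    of the original problem is feasible for the relaxation. *)
Lemma product_Sigma n (s : KA * KB) : feas s ->
  Sigma FA FB GA CA GB CB n.+1 (pure (state s.1) (state s.2)).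
Proof.
case: s => x y [/= Fx Fy Gx Gy]; have ext := power_extension x y n.
split; first by split; [exact: pure_state_max|exists (power_state x y n.+1)].
exists (power_state x y n.+1); split => //; split.
- by move=> g; rewrite /mapl slicel_power linearZ /= Fx scaler0.
- by move=> i _ f g; rewrite /mapr slicer_power linearZ /= Fy scaler0.
- move=> w g w0 g0; rewrite /mapl slicel_power linearZ /= linearZ mulr_ge0//; last exact: w0.
  by apply: prodr_ge0 => i _; exact: g0.
- move=> i _ f w g f0 w0 g0; rewrite /mapr slicer_power linearZ /= linearZ mulr_ge0//; last exact: w0.
  by rewrite mulr_ge0 ?f0//; apply: prodr_ge0 => j _; exact: g0.
Qed.

(** The inequality constraints on [y] are formulated by duality; the closedness of
    the cones turns them into membership. *)
Lemma conditional_feasible n (y : ntensor (A KA) (A KB) n.+1) (w : R) (s : KA * KB) :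
  [/\ forall g, mapl y FA g = 0,
      forall i : 'I_n.+1, val i = 0%N -> forall f g, mapr y FB i f g = 0,
      forall w g, dual_cone CA w -> (forall j, A_pos (g j)) ->
        0 <= w (mapl y GA g)
    & forall i : 'I_n.+1, val i = 0%N -> forall f w g,
        A_pos f -> dual_cone CB w -> (forall j, A_pos (g j)) ->
        0 <= w (mapr y GB i f g)] ->
  0 < w -> conditional y w s -> feas s.
Proof.
move=> [Fl Fr Gl Gr] w0 [[g g0 gE] [h h0 hE]].
have wn := lt0r_neq0 w0; split.
- have := Fl g; rewrite /mapl -gE linearZ => /eqP.
  by rewrite scaler_eq0 (negbTE wn) => /eqP.
- have := Fr ord0 erefl (unit_fun KA) h; rewrite /mapr -hE linearZ => /eqP.
  by rewrite scaler_eq0 (negbTE wn) => /eqP.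
- apply: bipolar hCA _ => u u0; have := Gl u g u0 g0.
  by rewrite /mapl -gE linearZ /= linearZ pmulr_rge0.
- apply: bipolar hCB _ => u u0; have := Gr ord0 erefl (unit_fun KA) u h (@unit_pos _ _ _) u0 h0.
  by rewrite /mapr -hE linearZ /= linearZ pmulr_rge0.
Qed.

(** In barycentric coordinates the objective is a polynomial on a product of two
    compact sets. *)
Lemma minimum_exists (P : dual (tensor (A KA) (A KB))) : (exists p, feas p) ->
  exists m, minimum [set P (pure (state p.1) (state p.2)) | p in feas] m.
Proof.
move=> [[x0 y0] [/= Fx0 Fy0 Gx0 Gy0]].
have [p [a [l [lE lc]]]] := barycentric_frame hA.
have [q [b [m [mE mc]]]] := barycentric_frame hB.
pose SA := barycentric l @` [set y | FA (state y) = 0 /\ CA (GA (state y))].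
pose SB := barycentric m @` [set y | FB (state y) = 0 /\ CB (GB (state y))].
have cS : compact (SA `*` SB).
  by apply: compact_setX; [exact: (feasible_compact lE)|exact: (feasible_compact mE)].
pose h (t : 'rV[R]_p * 'rV[R]_q) : R :=
  \sum_i \sum_j t.1 0 i * t.2 0 j * P (pure (state (a i)) (state (b j))).
have hE x y : P (pure (state x) (state y)) = h (barycentric l x, barycentric m y).
  rewrite (tensor_expand (frame_expand lE) (frame_expand mE) (pure _ _)) linear_sum.
  apply: eq_bigr => i _; rewrite linear_sum; apply: eq_bigr => j _.
  by rewrite linearZ !mxE.
have hc : continuous h.
  apply: continuous_sum => i; apply: continuous_sum => j t.
  apply: (@continuousM R _ (fun t : 'rV[R]_p * 'rV[R]_q => t.1 0 i * t.2 0 j) (fun=> _)); last exact: cst_continuous.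
  apply: (@continuousM R _ (fun t : 'rV[R]_p * 'rV[R]_q => t.1 0 i) (fun t => t.2 0 j)).
    apply: (@continuous_comp _ _ _ fst (fun r : 'rV[R]_p => r 0 i)); first exact: cvg_fst.
    exact: (@coord_continuous R 1 p 0 i).
  apply: (@continuous_comp _ _ _ snd (fun r : 'rV[R]_q => r 0 j)); first exact: cvg_snd.
  exact: (@coord_continuous R 1 q 0 j).
have S0 : SA `*` SB !=set0.
  by exists (barycentric l x0, barycentric m y0); split; [exists x0|exists y0].
have [t /set_mem[[x [Fx Gx] xt] [y [Fy Gy] yt]] tmin] :=
  compact_EVT_min S0 cS (continuous_subspaceT hc).
exists (P (pure (state x) (state y))); split; first by exists (x, y).
move=> _ [[x' y'] [/= Fx' Fy' Gx' Gy'] <-]; rewrite !hE.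
have -> : (barycentric l x, barycentric m y) = t by case: t xt yt {tmin} => ? ? /= -> ->.
by apply: tmin; apply/mem_set; split; [exists x'|exists y'].
Qed.

End Optimization.

Theorem theorem4p1 (R : realType) (VA VB : vectType R)
    (KA : set VA) (KB : set VB)
    (hKA : state_space KA) (hKB : state_space KB) :
  exists c : R,
    (forall (n : nat) (x : tensor (A KA) (A KB)),
       (1 <= n)%N -> Ext KA KB n x ->
       exists x' : tensor (A KA) (A KB),
         min_tensor KA KB x' /\
         base_norm (max_tensor KA KB) (x' - x) <= 2 * c / Num.sqrt n%:R)
    /\
    (forall (P : dual (tensor (A KA) (A KB)))
            (UA UB WA WB : vectType R) (CA : set WA) (CB : set WB)
            (FA : {linear dual (A KA) -> UA}) (FB : {linear dual (A KB) -> UB})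
            (GA : {linear dual (A KA) -> WA}) (GB : {linear dual (A KB) -> WB}),
       proper_cone CA -> proper_cone CB ->
       (exists p, feasible FA FB GA CA GB CB p) ->
       exists pstar : R,
         minimum [set P (pure (state p.1) (state p.2))
                 | p in feasible FA FB GA CA GB CB] pstar /\
         forall n : nat, (1 <= n)%N ->
           let pn := ereal_inf [set (P x)%:E | x in Sigma FA FB GA CA GB CB n] in
           (0 <= pstar%:E - pn)%E /\
           (pstar%:E - pn
              <= (2 * unit_norm (max_tensor KA KB) P * c / Num.sqrt n%:R)%:E)%E).
Proof.
have [c c0 dF] := de_finetti hKA hKB; exists c; split.
  move=> [//|n] x _ [_ [y ext]].
  have [r [w [s [w0 _ w1 close]]]] := dF n x y ext.
  exists (\sum_(b <- r) w b *: pure (state (s b).1) (state (s b).2)); split.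
    exact: min_tensor_sum.
  by apply: base_norm_le => //; rewrite !mulr_ge0// invr_ge0 sqrtr_ge0.
move=> P UA UB WA WB CA CB FA FB GA GB hCA hCB hfeas.
have [pstar pmin] := minimum_exists hKA hKB hCA hCB P hfeas.
exists pstar; split => // -[//|n] _ pn.
have [[p pfeas pE] plb] := pmin.
have pn_le : (pn <= pstar%:E)%E.
  by apply: ereal_inf_lbound; exists (pure (state p.1) (state p.2)); [exact: product_Sigma|rewrite pE].
set bnd := 2 * _ * c / _.
have pn_ge : ((pstar - bnd)%:E <= pn)%E.
  apply: le_ereal_inf_tmp => _ [x [_ [y [ext yc]]] <-]; rewrite lee_fin.
  have [r [w [s [w0 wc w1 close]]]] := dF n x y ext.
  have := close P; set x' := \sum_(b <- r) _.
  have : pstar <= P x'.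
    rewrite /x' linear_sum -[leLHS]mul1r -w1 mulr_suml; apply: ler_sum => b _.
    rewrite linearZ /=; have := w0 b; rewrite le_eqVlt => /predU1P[<-|wb].
      by rewrite !mul0r.
    rewrite ler_pM2l//; apply: plb; exists (s b) => //.
    exact: conditional_feasible yc wb (wc b wb).
  rewrite linearB => h1 /ler_normlW h2.
  have -> : bnd = unit_norm (max_tensor KA KB) P * (2 * c / Num.sqrt n.+1%:R).
    by rewrite /bnd; ring.
  lra.
clearbody pn; case: pn => [r|//|//] in pn_le pn_ge *.
move: pn_le pn_ge; rewrite -EFinB !lee_fin => r_le r_ge; split; lra.
Qed.
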